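(* Let $k\ge2$ be an integer. The $k$-equation high-order generalized-$\alpha$ method (defined in the context), with its parameters determined by $\rho^\infty$ as in the context, is L-stable for $\rho^\infty=0$; that is, it is A-stable, and every eigenvalue $\tilde\lambda$ of its amplification matrix $G(\theta)$ satisfies $\tilde\lambda\to0$ as $\theta\to\pm\infty$ ($\theta$ real).
   Context: The method is applied to the scalar test equation $\dot u+\lambda_\theta u=0$ with $\lambda_\theta\in\mathbb{C}$ and step size $\tau>0$; put $\theta=\tau\lambda_\theta$. The unknowns at step $n$ are $W_n^{(0)},\dots,W_n^{(2k-1)}\in\mathbb{C}$, with $W_n^{(i)}$ approximating $u^{(i)}(t_n)$. The unknowns at step $n+1$ are determined as follows. For $j=1,\dots,k-1$, with $Q_{n,j}=W^{(2j-1)}_{n+1}-\sum_{i=0}^{2k-2j}\frac{\tau^i}{i!}W^{(2j-1+i)}_n$, $$\sum_{i=0}^{2k-2j}\frac{\tau^i}{i!}W^{(2j-1+i)}_n+\alpha_jQ_{n,j}=-\lambda_\theta W^{(2j-2)}_{n+1},\qquad W^{(2j-2)}_{n+1}=\sum_{i=0}^{2k-2j+1}\frac{\tau^i}{i!}W^{(2j-2+i)}_n+\tau\gamma_jQ_{n,j},$$ and $$W^{(2k-1)}_n+\alpha_k\big(W^{(2k-1)}_{n+1}-W^{(2k-1)}_n\big)=-\lambda_\theta\big(W^{(2k-2)}_n+\alpha_f(W^{(2k-2)}_{n+1}-W^{(2k-2)}_n)\big),$$ $$W^{(2k-2)}_{n+1}=W^{(2k-2)}_n+\tau W^{(2k-1)}_n+\tau\gamma_k\big(W^{(2k-1)}_{n+1}-W^{(2k-1)}_n\big).$$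 The amplification matrix $G=G(\theta)$ is the $2k\times2k$ matrix with $\mathbf U_{n+1}=G\,\mathbf U_n$, where $\mathbf U_n=(W^{(0)}_n,\tau W^{(1)}_n,\dots,\tau^{2k-1}W^{(2k-1)}_n)^T$. It is block upper triangular with $2\times2$ diagonal blocks $$G_j=\frac{1}{\alpha_j+\gamma_j\theta}\begin{bmatrix}\alpha_j&\alpha_j-\gamma_j\\-\theta&\alpha_j+(\gamma_j-1)\theta-1\end{bmatrix}\ (j=1,\dots,k-1),$$ $$G_k=\frac{1}{\alpha_k+\alpha_f\gamma_k\theta}\begin{bmatrix}\alpha_k+(\alpha_f-1)\gamma_k\theta&\alpha_k-\gamma_k\\-\theta&\alpha_k+\alpha_f(\gamma_k-1)\theta-1\end{bmatrix}.$$ Parameters as functions of $\rho^\infty\in[0,1]$: $\alpha_j=\frac12\cdot\frac{3+\rho^\infty}{1+\rho^\infty}$ and $\gamma_j=\alpha_j-\frac12$ for $j=1,\dots,k-1$; $\alpha_k=\frac12\cdot\frac{3-\rho^\infty}{1+\rho^\infty}$, $\alpha_f=\frac1{1+\rho^\infty}$, $\gamma_k=\frac12-\alpha_f+\alpha_k$. A-stable means: for all $\theta\in\mathbb{C}$ with $\operatorname{Re}(\theta)\ge0$, all eigenvalues of $G(\theta)$ have modulus at most $1$. *)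

(* Defs.v *)
From HB Require Import structures.
From mathcomp Require Import all_boot all_order all_algebra.
From mathcomp Require Import complex.
From mathcomp Require Import all_classical reals topology normedtype.

Set Implicit Arguments.
Unset Strict Implicit.
Unset Printing Implicit Defensive.

Import Order.TTheory GRing.Theory Num.Theory.
Import numFieldNormedType.Exports.
Local Open Scope complex_scope.
Local Open Scope ring_scope.

(* A state [W : nat -> R[i]] holds the unknowns W^(0), ..., W^(2k-1); its
   values at indices >= 2k are never read. *)

Definition taylor (R : realType) (tau : R) (W : nat -> R[i]) (m N : nat) :
    R[i] :=
  \sum_(0 <= i < N.+1) (tau ^+ i / i`!%:R)%:C * W (m + i)%N.

(* The equation index j is 1-based, so the truncated subtractions below are
   exact for 1 <= j < k. *)
Definition Qres (R : realType) (k : nat) (tau : R) (W W' : nat -> R[i])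
    (j : nat) : R[i] :=
  W' (2 * j - 1)%N - taylor tau W (2 * j - 1) (2 * k - 2 * j).

(* One step from W to W' of the k-equation scheme for u' + lambda u = 0. *)
Definition galpha_step (R : realType) (k : nat) (alpha gamma : nat -> R)
    (alphaf tau : R) (lambda : R[i]) (W W' : nat -> R[i]) : Prop :=
  [/\ (forall j : nat, (1 <= j < k)%N ->
         taylor tau W (2 * j - 1) (2 * k - 2 * j)
           + (alpha j)%:C * Qres k tau W W' j
         = - lambda * W' (2 * j - 2)%N),
      (forall j : nat, (1 <= j < k)%N ->
         W' (2 * j - 2)%N
         = taylor tau W (2 * j - 2) (2 * k - 2 * j + 1)
           + tau%:C * (gamma j)%:C * Qres k tau W W' j),
      W (2 * k - 1)%N
        + (alpha k)%:C * (W' (2 * k - 1)%N - W (2 * k - 1)%N)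
      = - lambda * (W (2 * k - 2)%N
                    + alphaf%:C * (W' (2 * k - 2)%N - W (2 * k - 2)%N))
    & W' (2 * k - 2)%N
      = W (2 * k - 2)%N + tau%:C * W (2 * k - 1)%N
        + tau%:C * (gamma k)%:C * (W' (2 * k - 1)%N - W (2 * k - 1)%N)].

Definition par_alphaf (R : realType) (rho : R) : R := 1 / (1 + rho).

Definition par_alpha (R : realType) (k : nat) (rho : R) (j : nat) : R :=
  if (j < k)%N then 1 / 2 * ((3 + rho) / (1 + rho))
  else 1 / 2 * ((3 - rho) / (1 + rho)).

Definition par_gamma (R : realType) (k : nat) (rho : R) (j : nat) : R :=
  if (j < k)%N then par_alpha k rho j - 1 / 2
  else 1 / 2 - par_alphaf rho + par_alpha k rho j.

Definition scaled_state (R : realType) (k : nat) (tau : R)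
    (W : nat -> R[i]) : 'cV[R[i]]_(2 * k) :=
  \col_(i < 2 * k) ((tau ^+ i)%:C * W i).

(* The equivalence says both that the step is uniquely solvable for every W
   and that G maps the old scaled unknowns to the new ones. *)
Definition is_amplification_matrix (R : realType) (k : nat) (rho : R)
    (theta : R[i]) (G : 'M[R[i]]_(2 * k)) : Prop :=
  forall (tau : R) (lambda : R[i]), 0 < tau -> tau%:C * lambda = theta ->
  forall W W' : nat -> R[i],
    galpha_step k (par_alpha k rho) (par_gamma k rho) (par_alphaf rho)
      tau lambda W W'
    <-> scaled_state k tau W' = G *m scaled_state k tau W.

Lemma is_amplification_matrix_uniq (R : realType) (k : nat) (rho : R)
    (theta : R[i]) (G1 G2 : 'M[R[i]]_(2 * k)) :
  is_amplification_matrix rho theta G1 ->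
  is_amplification_matrix rho theta G2 -> G1 = G2.
Proof.
pose st (v : 'cV[R[i]]_(2 * k)) (n : nat) : R[i] :=
  if insub n is Some i then v i 0 else 0.
have stK v : scaled_state k 1 (st v) = v.
  by apply/colP => i; rewrite !mxE expr1n mul1r /st valK.
move=> h1 h2.
have G12 (v : 'cV[R[i]]_(2 * k)) : G1 *m v = G2 *m v.
  have e1 := h1 1 theta ltr01 (mul1r _) (st v) (st (G1 *m v)).
  have e2 := h2 1 theta ltr01 (mul1r _) (st v) (st (G1 *m v)).
  by move: e1 e2; rewrite !stK => -[_ e1] [e2 _]; apply: e2; apply: e1.
apply/matrixP => i j.
have /colP/(_ i) := G12 (delta_mx j 0).
by rewrite -!colE !mxE.
Qed.

(* In the next two definitions G is the amplification matrix G(theta), which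
   is unique by [is_amplification_matrix_uniq]; quantifying it existentially
   excludes vacuity at parameters where the step is not solvable. *)
Definition A_stable (R : realType) (k : nat) (rho : R) : Prop :=
  forall theta : R[i], 0 <= complex.Re theta ->
  exists G : 'M[R[i]]_(2 * k), is_amplification_matrix rho theta G /\
    forall z : R[i], eigenvalue G z -> `|z| <= 1.

(* All eigenvalues of G(x), x real, tend to 0 along the filter F. *)
Definition eigenvalues_vanish (R : realType) (k : nat) (rho : R)
    (F : set_system R) : Prop :=
  forall eps : R, 0 < eps -> \forall x \near F,
  exists G : 'M[R[i]]_(2 * k), is_amplification_matrix rho x%:C G /\
    forall z : R[i], eigenvalue G z -> `|z| < eps%:C.

Definition L_stable (R : realType) (k : nat) (rho : R) : Prop :=
  [/\ A_stable k rho,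
      eigenvalues_vanish k rho (pinfty_nbhs R)
    & eigenvalues_vanish k rho (ninfty_nbhs R)].

(* Main.v *)
Require Import Defs.
From mathcomp Require Import all_boot all_order all_algebra.
From mathcomp Require Import complex.
From mathcomp Require Import all_classical reals topology normedtype.
From mathcomp Require Import ring lra zify.

Set Implicit Arguments.
Unset Strict Implicit.
Unset Printing Implicit Defensive.

Import Order.TTheory GRing.Theory Num.Theory.
Import numFieldNormedType.Exports.
Local Open Scope complex_scope.
Local Open Scope ring_scope.

(** At rho = 0 one has alpha = 3/2 and gamma = 1 in every equation and
    alphaf = 1, so all k equations, the last one included, take the same form
    and every diagonal block of G(theta) equals
      1/d [[3/2, 1/2], [-theta, 1/2]]  with  d = 3/2 + theta.
    Its eigenvalues are the roots of d z^2 - 2 z + 1/2 = 0, the characteristic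
    equation of BDF2.  Multiplying by the square of the conjugate of z and
    taking real parts gives, with n = |z|^2,
      (n - Re z)^2 + n (n - 1) / 2 + n^2 Re theta = 0,
    which excludes n > 1 when Re theta >= 0; and |d| |z|^2 <= 2 |z| + 1/2
    forces z to 0 as |theta| grows. *)

Section TaylorCoefficients.
Variable F : fieldType.

(** The guard matters: for [j < m] the truncated [j - m] is 0 and would give the coefficient 1. *)
Definition taylor_coef (m j : nat) : F :=
  if (m <= j)%N then (j - m)`!%:R^-1 else 0.

(* G(theta) at rho = 0: rows 2b and 2b+1 are the solution of equation j = b+1
   for tau^(2b) W^(2b) and tau^(2b+1) W^(2b+1). *)
Definition galpha_mx (n : nat) (theta : F) : 'M[F]_n :=
  \matrix_(i < n, j < n)
   ((if odd i
     then - theta * taylor_coef i.-1 j + (theta + 1 / 2) * taylor_coef i j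
     else 3 / 2 * taylor_coef i j - taylor_coef i.+1 j) / (3 / 2 + theta)).

End TaylorCoefficients.

(** * The step at rho = 0 as a linear map of scaled unknowns *)

Section Scheme.
Variable R : realType.
Local Notation C := R[i].

(** The factor [tau ^+ m] turns each [tau ^+ i] into the scaling of unknown [m + i]; the order
    [k.-1 - m] makes the sum end at the last of [k] unknowns. *)
Lemma scaled_taylor (k m : nat) (tau : R) (W : nat -> C) : (m < k)%N ->
  (tau ^+ m)%:C * taylor tau W m (k.-1 - m)
  = \sum_(j < k) taylor_coef C m j * ((tau ^+ j)%:C * W j).
Proof.
move=> mk.
rewrite -(big_mkord xpredT
  (fun j => taylor_coef C m j * ((tau ^+ j)%:C * W j))).
rewrite (big_cat_nat (n := m)) //=; last exact: ltnW.
rewrite big_nat_cond big1 ?add0r; last first.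
  move=> j /andP[/andP[_ jm] _].
  by rewrite /taylor_coef leqNgt jm mul0r.
rewrite -[X in \sum_(X <= _ < _) _]add0n big_addn /taylor mulr_sumr.
have -> : (k - m = (k.-1 - m).+1)%N by lia.
apply: eq_bigr => i _.
rewrite /taylor_coef leq_addl addnK [(m + i)%N]addnC !exprD.
by rewrite !rmorphM /= fmorphV rmorph_nat; ring.
Qed.

(** Since alphaf = 1, the old value cancels on the right of the last equation, and its Taylor sums
    have one and two terms, so it fits the common pattern. Here [b] is the equation index counted
    from 0. *)
Lemma galpha_step0P (k : nat) (tau : R) (lambda : C) (W W' : nat -> C) :
  (0 < k)%N ->
  let T m := taylor tau W m ((2 * k).-1 - m) in
  galpha_step k (par_alpha k 0) (par_gamma k 0) (par_alphaf 0) tau lambda W W'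
  <-> forall b, (b < k)%N ->
      T b.*2.+1 + 3 / 2 * (W' b.*2.+1 - T b.*2.+1) = - lambda * W' b.*2
      /\ W' b.*2 = T b.*2 + tau%:C * (W' b.*2.+1 - T b.*2.+1).
Proof.
move=> k0 T.
have alR j : par_alpha k 0 j = 3 / 2 :> R.
  by rewrite /par_alpha; case: ifP => _; rewrite ?addr0 ?subr0 divr1 mul1r mulrC.
have al j : (par_alpha k 0 j : R)%:C = 3 / 2.
  by rewrite alR rmorphM fmorphV !rmorph_nat.
have ga j : (par_gamma k 0 j : R)%:C = 1.
  rewrite /par_gamma alR /par_alphaf addr0 divr1.
  by rewrite (_ : (if _ then _ else _) = 1) //; case: ifP => _; field.
have af : (par_alphaf 0 : R)%:C = 1.
  by rewrite /par_alphaf addr0 divr1.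
have To b : (b < k)%N -> T b.*2.+1 = taylor tau W b.*2.+1 (2 * k - 2 * b.+1).
  by move=> bk; rewrite /T; congr taylor; lia.
have Te b : (b < k)%N -> T b.*2 = taylor tau W b.*2 (2 * k - 2 * b.+1 + 1).
  by move=> bk; rewrite /T; congr taylor; lia.
have i1 b : (2 * b.+1 - 1 = b.*2.+1)%N by lia.
have i2 b : (2 * b.+1 - 2 = b.*2)%N by lia.
have Tl1 : T k.-1.*2.+1 = W k.-1.*2.+1.
  rewrite /T (_ : (_ - _ = 0)%N); last by lia.
  by rewrite /taylor big_nat1 expr0 fact0 divr1 mul1r addn0.
have Tl0 : T k.-1.*2 = W k.-1.*2 + tau%:C * W k.-1.*2.+1.
  rewrite /T (_ : (_ - _ = 1)%N); last by lia.
  rewrite /taylor big_nat_recr //= big_nat1 expr0 fact0 divr1 mul1r addn0.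
  by rewrite expr1 divr1 addn1.
have l1 : (2 * k - 1 = k.-1.*2.+1)%N by lia.
have l2 : (2 * k - 2 = k.-1.*2)%N by lia.
rewrite /galpha_step l1 l2 al ga af !mulr1 !mul1r; split.
  case=> h1 h2 h3 h4 b bk.
  have [bk1|bk1] := ltnP b.+1 k.
    have := h1 b.+1 bk1; have := h2 b.+1 bk1.
    by rewrite /Qres i1 i2 al ga To // Te // mulr1.
  have -> : b = k.-1 by lia.
  rewrite Tl1 Tl0; split; last exact: h4.
  by rewrite h3; ring.
move=> h; have [h3 h4] : _ /\ _ := h k.-1 ltac:(lia).
split.
- by case=> // b /andP[_ bk]; have [+ _] := h b (ltnW bk);
    rewrite /Qres i1 i2 al To // ltnW.
- by case=> // b /andP[_ bk]; have [_ +] := h b (ltnW bk);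
    rewrite /Qres i1 i2 ga mulr1 To ?Te // ltnW.
- by rewrite -[X in X + _]Tl1 -[X in _ - X]Tl1 h3; ring.
- by rewrite h4 Tl1 Tl0.
Qed.

(* One equation of the scheme at index 2b, multiplied by t = tau^(2b), solved
   for the new scaled unknowns. *)
Lemma galpha_block_solve (t tau lambda theta a b S0 S1 : C) :
  t != 0 -> tau != 0 -> tau * lambda = theta -> 3 / 2 + theta != 0 ->
  (S1 + 3 / 2 * (b - S1) = - lambda * a /\ a = S0 + tau * (b - S1))
  <-> t * a = (3 / 2 * (t * S0) - t * tau * S1) / (3 / 2 + theta)
      /\ t * tau * b = (- theta * (t * S0) + (theta + 1 / 2) * (t * tau * S1))
           / (3 / 2 + theta).
Proof.
move=> t0 tau0 <- d0.
have d0' : 3 + tau * lambda * 2 != 0.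
  apply: contraNneq d0 => e; apply/eqP.
  have -> : 3 / 2 + tau * lambda = (3 + tau * lambda * 2) / 2 :> C by field.
  by rewrite e mul0r.
split=> [[h1 h2]|[h1 h2]].
  (* Eliminating [a] leaves [b] with coefficient [3 / 2 + tau * lambda], the determinant of the 2x2
     system. *)
  have h : S1 + 3 / 2 * (b - S1) + lambda * (S0 + tau * (b - S1)) = 0.
    by rewrite -h2 h1; ring.
  have e : (3 / 2 + tau * lambda) * b
      = - lambda * S0 + (tau * lambda + 1 / 2) * S1.
    by apply/subr0_eq; rewrite -[RHS]h; field.
  have {}e : b = (- lambda * S0 + (tau * lambda + 1 / 2) * S1)
      / (3 / 2 + tau * lambda) by rewrite -e mulrC mulKf.
  by rewrite h2 e; split; field.
have {h1} -> : a = (3 / 2 * S0 - tau * S1) / (3 / 2 + tau * lambda).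
  by apply: (mulfI t0); rewrite h1; field.
have {h2} -> : b = (- lambda * S0 + (tau * lambda + 1 / 2) * S1)
    / (3 / 2 + tau * lambda).
  by apply: (mulfI (mulf_neq0 t0 tau0)); rewrite h2; field.
by split; field.
Qed.

Lemma galpha_mx_amplification (k : nat) (theta : C) :
  (0 < k)%N -> 3 / 2 + theta != 0 ->
  is_amplification_matrix 0 theta (galpha_mx (2 * k) theta).
Proof.
move=> k0 d0 tau lambda tau0 tl W W'.
pose X m := (tau ^+ m)%:C * taylor tau W m ((2 * k).-1 - m).
have tauC : tau%:C != 0 by rewrite (fmorph_eq0 (real_complex R)) gt_eqF.
have tpow m : (tau ^+ m)%:C = tau%:C ^+ m by rewrite rmorphXn.
have GE (i : 'I_(2 * k)) :
    (galpha_mx (2 * k) theta *m scaled_state k tau W) i 0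
    = (if odd i then - theta * X i.-1 + (theta + 1 / 2) * X i
       else 3 / 2 * X i - X i.+1) / (3 / 2 + theta).
  have ik := ltn_ord i.
  have ik1 : odd i -> (i.-1 < 2 * k)%N by lia.
  (* As [2 * k] is even, the block of an even row is never cut off. *)
  have ik2 : ~~ odd i -> (i.+1 < 2 * k)%N by lia.
  rewrite mxE /X; case: ifPn => oi.
    rewrite !scaled_taylor ?ik1 // !mulr_sumr -big_split mulr_suml.
    by apply: eq_bigr => j _; rewrite !mxE oi /=; ring.
  rewrite !scaled_taylor ?ik2 // mulr_sumr -sumrB mulr_suml.
  by apply: eq_bigr => j _; rewrite !mxE (negbTE oi) /=; ring.
apply: (iff_trans (galpha_step0P _ _ _ _ k0)).
have solve b := galpha_block_solve (W' b.*2) (W' b.*2.+1)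
  (taylor tau W b.*2 ((2 * k).-1 - b.*2))
  (taylor tau W b.*2.+1 ((2 * k).-1 - b.*2.+1))
  (expf_neq0 b.*2 tauC) tauC tl d0.
have XE b : X b.*2
    = tau%:C ^+ b.*2 * taylor tau W b.*2 ((2 * k).-1 - b.*2).
  by rewrite /X tpow.
have XO b : X b.*2.+1 = tau%:C ^+ b.*2 * tau%:C
    * taylor tau W b.*2.+1 ((2 * k).-1 - b.*2.+1).
  by rewrite /X tpow exprSr.
split=> [h|/colP h b bk].
  apply/colP => i; rewrite GE mxE tpow.
  have bk : (i./2 < k)%N by have := ltn_ord i; lia.
  have [hE hO] := (solve i./2).1 (h _ bk).
  case: ifPn => oi.
    have -> : i = i./2.*2.+1 :> nat by lia.
    by rewrite XE XO exprSr hO.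
  have -> : i = i./2.*2 :> nat by lia.
  by rewrite XE XO hE.
have bE : (b.*2 < 2 * k)%N by lia.
have bO : (b.*2.+1 < 2 * k)%N by lia.
apply/(solve b); split.
  by have := h (Ordinal bE); rewrite GE mxE /= odd_double tpow XE XO.
by have := h (Ordinal bO); rewrite GE mxE /= odd_double tpow XE XO exprSr.
Qed.

End Scheme.

(** * Block triangularity and the characteristic equation *)

Lemma galpha_mx_block_upper (F : fieldType) (n : nat) (theta : F)
    (i j : 'I_n) :
  (j./2 < i./2)%N -> galpha_mx n theta i j = 0.
Proof.
move=> ij; rewrite mxE /taylor_coef.
have ijF : (i <= j)%N = false by lia.
have SijF : (i.+1 <= j)%N = false by lia.
case: ifP => oi; rewrite ijF.
  have -> : (i.-1 <= j)%N = false by lia.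
  by rewrite !mulr0 addr0 mul0r.
by rewrite SijF mulr0 subr0 mul0r.
Qed.

(* The first nonzero 2-block of a left eigenvector is a left eigenvector of
   the corresponding diagonal block. *)
Lemma galpha_mx_eigenvalue (F : numFieldType) (k : nat) (theta z : F) :
  3 / 2 + theta != 0 -> eigenvalue (galpha_mx (2 * k) theta) z ->
  (3 / 2 + theta) * z ^+ 2 - 2 * z + 1 / 2 = 0.
Proof.
move=> d0 /eigenvalueP[v vG v0].
have [i0 vi0] : exists i, v 0 i != 0.
  by apply/existsP; apply: contraNT v0 => /existsPn v0; apply/eqP/rowP => i;
    rewrite mxE; apply/eqP/negPn.
case: (@arg_minnP _ i0 (fun i => v 0 i != 0) val vi0) => i vi imin.
have ik := ltn_ord i.
have bE : (i./2.*2 < 2 * k)%N by lia.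
have bO : (i./2.*2.+1 < 2 * k)%N by lia.
pose e := Ordinal bE; pose o := Ordinal bO.
(* In the columns of this block, earlier rows drop out by minimality of [i], later ones by block
   triangularity. *)
have block (c : 'I_(2 * k)) : c./2 = i./2 ->
    z * v 0 c = v 0 e * galpha_mx (2 * k) theta e c
              + v 0 o * galpha_mx (2 * k) theta o c.
  move=> ci; have /rowP/(_ c) := vG; rewrite [LHS]mxE [RHS]mxE => <-.
  rewrite (bigD1 e) //= (bigD1 o) ?andTb; last by rewrite -val_eqE /=; lia.
  rewrite big1 => [|r]; first by rewrite /= addr0.
  rewrite -!val_eqE /= => /andP[re ro].
  have [ri|ir] := ltnP r i.
    have -> : v 0 r = 0; last by rewrite mul0r.
    by apply/eqP; apply: contraTT ri => /imin; rewrite -leqNgt.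
  by rewrite galpha_mx_block_upper ?mulr0 // ci; lia.
have := block e (half_double _).
have := block o; rewrite /= uphalf_double => /(_ erefl).
rewrite !mxE /taylor_coef /= odd_double /= !leqnn !ltnn ltnW //.
rewrite subSnn !subnn /=.
have pq0 : v 0 e != 0 \/ v 0 o != 0.
  have [ie|io] : i = e \/ i = o.
  - by case: (boolP (odd i)) => oi; [right|left]; apply/val_inj => /=; lia.
  - by left; rewrite -ie.
  - by right; rewrite -io.
move: pq0; set p := v 0 e; set q := v 0 o => pq0.
rewrite (_ : 1`! = 1)%N // fact0 !invr1 !mulr1 mulr0 subr0 addr0.
have [d dE] : {d | d = 3 / 2 + theta} by exists (3 / 2 + theta).
have -> : theta = d - 3 / 2 by rewrite dE addrAC subrr add0r.
rewrite addrCA subrr addr0; rewrite -dE in d0 => eqO eqE.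
have {}eqO : z * d * q - p / 2 - q / 2 = 0 by rewrite mulrAC eqO; field.
have {}eqE : z * d * p - 3 / 2 * p + (d - 3 / 2) * q = 0.
  by rewrite mulrAC eqE; field.
(* If [q] were 0, the odd column would force [p = 0] as well. *)
have q0 : q != 0.
  case: pq0 => //; apply: contraNneq => q0.
  move/eqP: eqO; rewrite q0 mulr0 mul0r sub0r subr0 oppr_eq0.
  by rewrite mulf_eq0 invr_eq0 pnatr_eq0 orbF.
apply: (mulfI (mulf_neq0 d0 q0)); rewrite mulr0.
(* The multiplier [2 * z * d - 3] cancels [p]; what remains is [d * q] times the quadratic. *)
transitivity (((2 * z * d - 3) * (z * d * q - p / 2 - q / 2)
  + (z * d * p - 3 / 2 * p + (d - 3 / 2) * q)) / 2); first by field.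
by rewrite eqO eqE mulr0 addr0 mul0r.
Qed.

(** * Roots of the BDF2 characteristic equation *)

Lemma realC_half (R : realType) (n : nat) : (n%:R / 2 : R)%:C = n%:R / 2.
Proof. by rewrite rmorphM fmorphV !rmorph_nat. Qed.

Lemma bdf2_root_bound (R : realType) (theta z : R[i]) :
  0 <= complex.Re theta ->
  (3 / 2 + theta) * z ^+ 2 - 2 * z + 1 / 2 = 0 -> `|z| <= 1.
Proof.
case: theta z => [p r] [a b] /= p0 ez.
suff n_le1 : a ^+ 2 + b ^+ 2 <= 1.
  by rewrite normc_def /= lecR -sqrtr1 ler_wsqrtr.
move: ez.
have two : 2 = 2 +i* 0 :> R[i] by rewrite -[RHS]/(real_complex R _) rmorph_nat.
rewrite -(realC_half R 3) -(realC_half R 1) two expr2; simpc => -[eRe eIm].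
rewrite leNgt; apply/negP => n1; set n := a ^+ 2 + b ^+ 2 in n1.
suff : (n - a) ^+ 2 + n * (n - 1) / 2 + p * n ^+ 2 = 0.
  have := sqr_ge0 (n - a); have := mulr_ge0 p0 (sqr_ge0 n).
  have : 0 < n * (n - 1) by rewrite mulr_gt0 ?subr_gt0 // (lt_trans ltr01).
  lra.
(* The zeros stand for the real and imaginary parts of the equation; these weights form the real
   part of its product with the squared conjugate of [z]. *)
have : (a ^+ 2 - b ^+ 2) * 0 + 2 * a * b * 0 = 0 :> R by ring.
by rewrite -{1}eRe -{1}eIm => <-; rewrite /n; field.
Qed.

(** The threshold is [(2 * eps + 1 / 2) / eps ^+ 2], the value of [(2 * r + 1 / 2) / r ^+ 2] at
    [r = eps]; this decreasing function of [r] bounds the leading coefficient when [r] is the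
    modulus of [z]. *)
Lemma bdf2_root_small (R : realType) (eps x : R) (z : R[i]) :
  0 < eps -> 2 / eps + 1 / (2 * eps ^+ 2) < `|3 / 2 + x| ->
  (3 / 2 + x%:C) * z ^+ 2 - 2 * z + 1 / 2 = 0 -> `|z| < eps%:C.
Proof.
move=> eps0 xbig ez.
have [r [zr r0]] : exists r, `|z| = r%:C /\ 0 <= r.
  by rewrite normc_def; eexists; split; [reflexivity | exact: sqrtr_ge0].
rewrite zr ltcR ltNge; apply/negP => er.
set D := `|3 / 2 + x| in xbig.
have dD : `|3 / 2 + x%:C| = D%:C.
  have -> : 3 / 2 + x%:C = (3 / 2 + x)%:C by rewrite -(realC_half R 3) rmorphD.
  by rewrite normc_def /= expr0n addr0 sqrtr_sqr.
have : D * r ^+ 2 <= 2 * r + 1 / 2.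
  rewrite -lecR; have -> : (D * r ^+ 2)%:C = `|(3 / 2 + x%:C) * z ^+ 2|.
    by rewrite normrM normrX zr dD rmorphM rmorphXn.
  have -> : (3 / 2 + x%:C) * z ^+ 2 = 2 * z - 1 / 2.
    by apply/subr0_eq; rewrite -ez; ring.
  apply: le_trans (ler_normB _ _) _.
  by rewrite normrM zr !ger0_norm ?divr_ge0 // rmorphD !rmorphM fmorphV !rmorph_nat.
rewrite leNgt => /negP; apply.
have r1 : 0 < r by apply: lt_le_trans er.
apply: (@le_lt_trans _ _ ((2 / eps + 1 / (2 * eps ^+ 2)) * r ^+ 2)); last first.
  by rewrite ltr_pM2r // exprn_gt0.
have [u ru] : {u | r = eps * u} by exists (r / eps); rewrite mulrC divfK ?gt_eqF.
have u1 : 1 <= u by rewrite -(ler_pM2l eps0) mulr1 -ru.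
have -> : (2 / eps + 1 / (2 * eps ^+ 2)) * r ^+ 2 = 2 * r * u + u ^+ 2 / 2.
  by rewrite ru; field; rewrite gt_eqF.
by apply: lerD; nra.
Qed.

(** Serves both limits: a large [3 / 2 + x] makes the step solvable and the roots small. *)
Lemma eigenvalues_vanish_far (R : realType) (k : nat) (F : set_system R) :
  Filter F -> (0 < k)%N ->
  (forall M : R, \forall x \near F, M < `|3 / 2 + x|) ->
  eigenvalues_vanish k 0 F.
Proof.
move=> FF k0 far eps eps0.
apply: filterS (far (2 / eps + 1 / (2 * eps ^+ 2))) => x xbig.
have d0 : 3 / 2 + x%:C != 0 :> R[i].
  have -> : 3 / 2 + x%:C = (3 / 2 + x)%:C :> R[i].
    by rewrite -(realC_half R 3) rmorphD.
  rewrite (fmorph_eq0 (real_complex R)) -normr_gt0; apply: lt_trans xbig.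
  by rewrite addr_gt0 // divr_gt0 // mulr_gt0 // exprn_gt0.
exists (galpha_mx (2 * k) x%:C); split; first exact: galpha_mx_amplification.
by move=> z /(galpha_mx_eigenvalue d0); apply: bdf2_root_small.
Qed.

Theorem theorem3 (R : realType) (k : nat) (hk : (2 <= k)%N) :
  L_stable k (0%R : R).
Proof.
have k0 : (0 < k)%N := ltnW hk.
split.
- move=> theta theta0.
  (* Its real part is at least 3/2. *)
  have d0 : 3 / 2 + theta != 0.
    apply: contraTneq theta0 => /(congr1 (@complex.Re R)) e.
    have {}e : 3 / 2 + complex.Re theta = 0.
      by rewrite -[RHS]e -(realC_half _ 3) raddfD.
    by rewrite -ltNge; lra.
  exists (galpha_mx (2 * k) theta).
  split; first exact: galpha_mx_amplification.
  by move=> z /(galpha_mx_eigenvalue d0); apply: bdf2_root_bound.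
- apply: eigenvalues_vanish_far => // M.
  apply: filterS (nbhs_pinfty_gt (num_real M)) => x Mx.
  by apply: lt_le_trans (ler_norm _); lra.
- apply: eigenvalues_vanish_far => // M.
  apply: filterS (nbhs_ninfty_lt (num_real (- M - 3 / 2))) => x Mx.
  by rewrite -normrN; apply: lt_le_trans (ler_norm _); lra.
Qed.
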